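(* Let $G$ be a simple, simply-connected linear algebraic group over $\mathbb{C}$, let $L$ be a simple Levi subgroup of $G$, and let $i\in\Delta(L)$. Then the extremal ray $(\varpi_i,v_{\Delta(L)}(\varpi_i))$ of $\mathscr{K}(G)$ satisfies $$(\varpi_i,v_{\Delta(L)}(\varpi_i))=\mathrm{Ind}_L^G(\varpi_i^L,0).$$
   Context: Fix a maximal torus and Borel subgroup $T\subset B\subset G$; let $\alpha_1,\dots,\alpha_r$ be the simple roots, $\alpha_1^\vee,\dots,\alpha_r^\vee$ the simple coroots, $\varpi_1,\dots,\varpi_r$ the fundamental weights, and $x_1,\dots,x_r\in X_*(T)\otimes\mathbb{Q}$ the fundamental coweights ($\langle\alpha_i,x_j\rangle=\delta_{ij}$). Levi subgroups: for $I\subseteq\{1,\dots,r\}$, the Levi subgroup $L=L_I$ means the semisimple part of the standard Levi subgroup whose simple roots are $\alpha_i$, $i\in I$; write $\Delta(L)=I$. It is simple when the Dynkin subdiagram on $I$ is connected (and nonempty). The fundamental weights of $L$ are denoted $\varpi_i^L$, $i\in\Delta(L)$. Kostka cone: for $H=G$ or $L$, $\mathscr{K}(H)$ is the rational cone generated by the pairs $(\lambda,\mu)$ of dominant integral weights of $H$ such that the $\mu$-weight space of the irreducible $H$-representation of highest weight $\lambda$ is nonzero; equivalently, $\lambda,\mu$ are rational dominant and $\lambda-\mu$ is a nonnegative rational combination of simple roots of $H$. Induction: for $(\lambda_L,\mu_L)\in\mathscr{K}(L)$ write $\lambda_L-\mu_L=\sum_{k\in\Delta(L)}c_k\alpha_k$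 (simple roots of $L$). Let $\lambda$ be the extension by $0$ of $\lambda_L$, i.e. the weight of $G$ with $\langle\lambda,\alpha_k^\vee\rangle=\langle\lambda_L,\alpha_k^\vee\rangle$ for $k\in\Delta(L)$ and $\langle\lambda,\alpha_k^\vee\rangle=0$ for $k\notin\Delta(L)$. Then $\mathrm{Ind}_L^G(\lambda_L,\mu_L)=(\lambda,\lambda-\sum_{k\in\Delta(L)}c_k\alpha_k)$. Vertices: for a dominant weight $\lambda$ of $G$, $v_{\Delta(L)}(\lambda)=v_{I,J}(\lambda)$ with $I=\Delta(L)$, $J=\{1,\dots,r\}\setminus I$, where $v_{I,J}(\lambda)$ is the unique solution $x\in X^*(T)\otimes\mathbb{Q}$ of $\langle x,\alpha_i^\vee\rangle=0$ for $i\in I$ and $\langle\lambda-x,x_j\rangle=0$ for $j\in J$. *)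

(* Defs.v *)
From HB Require Import structures.
From mathcomp Require Import all_boot all_order all_algebra.

Set Implicit Arguments.
Unset Strict Implicit.
Unset Printing Implicit Defensive.

Import Order.TTheory GRing.Theory Num.Theory.
Local Open Scope ring_scope.

(* For a torus T of rank r, a Z-basis of X^*(T) and the dual basis of X_*(T)
   identify both lattices with Z^r, and the perfect pairing with this one. *)
Definition pairing (R : comNzRingType) (r : nat) (x y : 'rV[R]_r) : R :=
  (x *m y^T) 0 0.

Definition ratv (r : nat) (x : 'rV[int]_r) : 'rV[rat]_r := map_mx intr x.

(* The simple roots and coroots of a semisimple group of rank r. *)
Record baseDatum (r : nat) := BaseDatum {
  sroot : 'I_r -> 'rV[int]_r;
  scoroot : 'I_r -> 'rV[int]_r
}.

Definition sroot_mx (r : nat) (D : baseDatum r) : 'M[rat]_r :=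
  \matrix_k ratv (sroot D k).

Definition scoroot_mx (r : nat) (D : baseDatum r) : 'M[rat]_r :=
  \matrix_k ratv (scoroot D k).

(* A reduced based root datum of a semisimple group G over C, relative to
   T <= B <= G.  By the existence and isomorphism theorems these classify the
   triples (G, B, T).  Semisimplicity: there are as many simple roots as the
   rank of T, and they are linearly independent.  The value of [coroot] matters
   only on [roots]. *)
Record rootDatum (r : nat) := RootDatum {
  base :> baseDatum r;
  roots : seq 'rV[int]_r;
  coroot : 'rV[int]_r -> 'rV[int]_r;
  coroot_inj : {in roots &, injective coroot};
  pairing_root_coroot : {in roots, forall a, pairing a (coroot a) = 2};
  reflection_root :
    {in roots &, forall a b, b - pairing b (coroot a) *: a \in roots};
  reflection_coroot :
    {in roots &, forall a b,
       coroot b - pairing a (coroot b) *: coroot a \in map coroot roots};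
  roots_reduced : {in roots, forall a, 2 *: a \notin roots};
  sroot_roots : forall k, sroot base k \in roots;
  scorootE : forall k, scoroot base k = coroot (sroot base k);
  sroot_free : sroot_mx base \in unitmx;
  sroot_base : {in roots, forall a, exists c : 'I_r -> nat,
    a = \sum_k (c k)%:Z *: sroot base k \/
    a = - \sum_k (c k)%:Z *: sroot base k}
}.

(* The simple coroots form a Z-basis of X_*(T). *)
Definition simply_connected (r : nat) (D : baseDatum r) : Prop :=
  (\matrix_k scoroot D k : 'M[int]_r) \in unitmx.

Definition dynkin (r : nat) (D : baseDatum r) : rel 'I_r :=
  [rel i j | (i != j) && (pairing (sroot D i) (scoroot D j) != 0)].

(* The Dynkin diagram is nonempty and connected. *)
Definition is_simple (r : nat) (D : baseDatum r) : Prop :=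
  (0 < r)%N /\ forall i j : 'I_r, connect (dynkin D) i j.

(* The semisimple part L of the standard Levi subgroup on I, for G simply
   connected.  The alpha_k^vee (k in I) form a basis of the cocharacter lattice
   of its maximal torus T_L; coordinates are taken in this basis and its dual,
   so that a character x of T restricts to the row of the <x, alpha_k^vee>.
   The elements of I are numbered by [enum_val : 'I_#|I| -> 'I_r]. *)
Definition levi (r : nat) (D : baseDatum r) (I : {set 'I_r}) :
    baseDatum #|I| :=
  BaseDatum
    (fun k => \row_j pairing (sroot D (enum_val k)) (scoroot D (enum_val j)))
    (fun k => delta_mx 0 k).

(* See [fund_weightP]. *)
Definition fund_weight (r : nat) (D : baseDatum r) (i : 'I_r) : 'rV[rat]_r :=
  row i (invmx (scoroot_mx D)^T).

(* See [fund_coweightP]. *)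
Definition fund_coweight (r : nat) (D : baseDatum r) (j : 'I_r) : 'rV[rat]_r :=
  row j (invmx (sroot_mx D)^T).

Definition dominant (r : nat) (D : baseDatum r) (x : 'rV[rat]_r) : Prop :=
  forall k, 0 <= pairing x (ratv (scoroot D k)).

(* Stated through the dominance order rather than through nonzero weight
   spaces; the rational cone generated is the same. *)
Definition kostka_cone (r : nat) (D : baseDatum r)
    (p : 'rV[rat]_r * 'rV[rat]_r) : Prop :=
  [/\ dominant D p.1, dominant D p.2 &
      exists c : 'I_r -> rat,
        (forall k, 0 <= c k) /\ p.1 - p.2 = \sum_k c k *: ratv (sroot D k)].

(* The ray spanned by p is an extremal ray of the convex cone C. *)
Definition extremal_ray (V : lmodType rat) (C : V -> Prop) (p : V) : Prop :=
  [/\ C p, p != 0 &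
      forall a b : V, C a -> C b -> a + b = p ->
        exists s : rat, 0 <= s /\ a = s *: p].

(* v_{I,J}(lambda) with J the complement of I. *)
Definition is_vertex (r : nat) (D : baseDatum r) (I : {set 'I_r})
    (lambda x : 'rV[rat]_r) : Prop :=
  (forall i, i \in I -> pairing x (ratv (scoroot D i)) = 0) /\
  (forall j, j \notin I -> pairing (lambda - x) (fund_coweight D j) = 0).

(* The solution of this square linear system; see [vertexP]. *)
Definition vertex_mx (r : nat) (D : baseDatum r) (I : {set 'I_r}) :
    'M[rat]_r :=
  \matrix_k (if k \in I then ratv (scoroot D k) else fund_coweight D k).

Definition vertex (r : nat) (D : baseDatum r) (I : {set 'I_r})
    (lambda : 'rV[rat]_r) : 'rV[rat]_r :=
  (\row_k (if k \in I then 0 else pairing lambda (fund_coweight D k)))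
    *m invmx (vertex_mx D I)^T.

(* Coordinates in the basis of simple roots; see [root_coordP]. *)
Definition root_coord (r : nat) (D : baseDatum r) (x : 'rV[rat]_r)
    (k : 'I_r) : rat :=
  (x *m invmx (sroot_mx D)) 0 k.

(* Extension by 0 of a weight of L; see [ext0_in] and [ext0_out]. *)
Definition ext0 (r : nat) (D : baseDatum r) (I : {set 'I_r})
    (x : 'rV[rat]_#|I|) : 'rV[rat]_r :=
  \sum_k pairing x (ratv (scoroot (levi D I) k)) *: fund_weight D (enum_val k).

Definition Ind (r : nat) (D : baseDatum r) (I : {set 'I_r})
    (p : 'rV[rat]_#|I| * 'rV[rat]_#|I|) : 'rV[rat]_r * 'rV[rat]_r :=
  let lambda := ext0 D p.1 in
  (lambda,
   lambda - \sum_k root_coord (levi D I) (p.1 - p.2) k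
              *: ratv (sroot D (enum_val k))).

Lemma pairingE (R : comNzRingType) r (x y : 'rV[R]_r) :
  pairing x y = \sum_k x 0 k * y 0 k.
Proof. by rewrite /pairing mxE; apply: eq_bigr => k _; rewrite mxE. Qed.

Lemma pairingDl (R : comNzRingType) r (x y z : 'rV[R]_r) :
  pairing (x + y) z = pairing x z + pairing y z.
Proof. by rewrite /pairing mulmxDl mxE. Qed.

Lemma pairingNl (R : comNzRingType) r (x z : 'rV[R]_r) :
  pairing (- x) z = - pairing x z.
Proof. by rewrite /pairing mulNmx mxE. Qed.

Lemma pairingZl (R : comNzRingType) r a (x z : 'rV[R]_r) :
  pairing (a *: x) z = a * pairing x z.
Proof. by rewrite /pairing -scalemxAl mxE. Qed.

Lemma pairingC (R : comNzRingType) r (x z : 'rV[R]_r) :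
  pairing x z = pairing z x.
Proof. by rewrite !pairingE; apply: eq_bigr => k _; rewrite mulrC. Qed.

Lemma pairing_suml (R : comNzRingType) r (J : finType) (P : pred J)
    (F : J -> 'rV[R]_r) z :
  pairing (\sum_(i | P i) F i) z = \sum_(i | P i) pairing (F i) z.
Proof. by rewrite /pairing mulmx_suml summxE. Qed.

Lemma pairing_ratv r (x y : 'rV[int]_r) :
  pairing (ratv x) (ratv y) = (pairing x y)%:~R.
Proof.
rewrite !pairingE rmorph_sum; apply: eq_bigr => k _.
by rewrite !mxE rmorphM.
Qed.

Lemma pairing_rows r m (x : 'rV[rat]_r) (F : 'I_m -> 'rV[rat]_r) k :
  (x *m (\matrix_j F j)^T) 0 k = pairing x (F k).
Proof. by rewrite mxE pairingE; apply: eq_bigr => j _; rewrite !mxE. Qed.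

Lemma dual_basisP r (F : 'I_r -> 'rV[rat]_r) i k :
  \matrix_j F j \in unitmx ->
  pairing (row i (invmx (\matrix_j F j)^T)) (F k) = (i == k)%:R.
Proof.
move=> uF; rewrite -pairing_rows -row_mul mulVmx ?unitmx_tr //.
by rewrite !mxE.
Qed.

Lemma scoroot_unit r (D : baseDatum r) :
  simply_connected D -> scoroot_mx D \in unitmx.
Proof.
move=> scD; have -> : scoroot_mx D = map_mx intr (\matrix_k scoroot D k).
  by apply/matrixP => i j; rewrite !mxE.
by rewrite unitmxE det_map_mx rmorph_unit -?unitmxE.
Qed.

Lemma simply_connected_levi r (D : baseDatum r) (I : {set 'I_r}) :
  simply_connected (levi D I).
Proof.
rewrite /simply_connected.
suff -> : \matrix_k scoroot (levi D I) k = 1%:M by exact: unitmx1.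
by apply/matrixP => i j; rewrite !mxE eq_sym.
Qed.

Lemma fund_weightP r (D : baseDatum r) i k : simply_connected D ->
  pairing (fund_weight D i) (ratv (scoroot D k)) = (i == k)%:R.
Proof. by move=> /scoroot_unit; apply: dual_basisP. Qed.

Lemma fund_coweightP r (D : rootDatum r) i j :
  pairing (ratv (sroot D i)) (fund_coweight D j) = (i == j)%:R.
Proof.
by rewrite pairingC eq_sym; apply: dual_basisP; apply: sroot_free.
Qed.

Lemma ext0_in r (D : baseDatum r) (I : {set 'I_r}) (x : 'rV[rat]_#|I|) k :
  simply_connected D ->
  pairing (ext0 D x) (ratv (scoroot D (enum_val k))) =
  pairing x (ratv (scoroot (levi D I) k)).
Proof.
move=> scD; rewrite pairing_suml (bigD1 k) //= big1 => [|j nejk].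
  by rewrite pairingZl fund_weightP // eqxx mulr1 addr0.
rewrite pairingZl fund_weightP // (inj_eq enum_val_inj) (negPf nejk).
by rewrite mulr0.
Qed.

Lemma ext0_out r (D : baseDatum r) (I : {set 'I_r}) (x : 'rV[rat]_#|I|) k :
  simply_connected D -> k \notin I ->
  pairing (ext0 D x) (ratv (scoroot D k)) = 0.
Proof.
move=> scD nIk; rewrite pairing_suml big1 // => j _.
rewrite pairingZl fund_weightP //; case: eqP => [jk|]; last by rewrite mulr0.
by rewrite -jk enum_valP in nIk.
Qed.

(* The Weyl-invariant form sum_a <x, a^vee> <y, a^vee>. *)
Definition weyl_form r (G : rootDatum r) (x y : 'rV[rat]_r) : rat :=
  \sum_(f <- undup (map (coroot G) (roots G)))
    pairing x (ratv f) * pairing y (ratv f).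

Lemma weyl_formC r (G : rootDatum r) x y : weyl_form G x y = weyl_form G y x.
Proof. by apply: eq_bigr => f _; rewrite mulrC. Qed.

Lemma weyl_formDl r (G : rootDatum r) x y z :
  weyl_form G (x + y) z = weyl_form G x z + weyl_form G y z.
Proof.
rewrite /weyl_form -big_split.
by apply: eq_bigr => f _; rewrite pairingDl mulrDl.
Qed.

Lemma weyl_formZl r (G : rootDatum r) a x z :
  weyl_form G (a *: x) z = a * weyl_form G x z.
Proof.
rewrite /weyl_form mulr_sumr.
by apply: eq_bigr => f _; rewrite pairingZl mulrA.
Qed.

Lemma weyl_form_refl r (G : rootDatum r) a (x y : 'rV[rat]_r) : a \in roots G ->
  let s z := z - pairing z (ratv (coroot G a)) *: ratv a in
  weyl_form G (s x) (s y) = weyl_form G x y.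
Proof.
move=> Ga s; pose t f := f - pairing a f *: coroot G a.
have tK : involutive t.
  move=> f; rewrite /t.
  have -> : pairing a (f - pairing a f *: coroot G a) = - pairing a f.
    rewrite pairingC pairingDl pairingNl pairingZl pairingC.
    rewrite [pairing (coroot G a) a]pairingC pairing_root_coroot //.
    by rewrite mulr_natr mulr2n opprD addrA subrr sub0r.
  by rewrite scaleNr opprK subrK.
have st z f : pairing (s z) (ratv f) = pairing z (ratv (t f)).
  have -> : ratv (t f) = ratv f - (pairing a f)%:~R *: ratv (coroot G a).
    by apply/rowP => k; rewrite !mxE rmorphB rmorphM.
  rewrite /s pairingDl pairingNl pairingZl pairing_ratv.
  rewrite [RHS]pairingC pairingDl pairingNl pairingZl.
  by rewrite ![pairing _ z]pairingC mulrC.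
have tT : perm_eq (map t (undup (map (coroot G) (roots G))))
                  (undup (map (coroot G) (roots G))).
  have ut : uniq (map t (undup (map (coroot G) (roots G)))).
    by rewrite map_inj_uniq ?undup_uniq //; apply: inv_inj.
  apply: uniq_perm; rewrite ?undup_uniq //.
  have sub : {subset map t (undup (map (coroot G) (roots G))) <=
              undup (map (coroot G) (roots G))}.
    move=> g /mapP[f]; rewrite mem_undup => /mapP[b Gb ->] ->.
    by rewrite mem_undup reflection_coroot.
  by case: (uniq_min_size ut sub); rewrite // size_map.
rewrite /weyl_form; under eq_bigr => f _ do rewrite !st.
by rewrite -(perm_big _ tT) /= big_map; apply: eq_bigr => f _; rewrite !tK.
Qed.

Lemma weyl_form_root r (G : rootDatum r) a (x : 'rV[rat]_r) : a \in roots G ->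
  pairing x (ratv (coroot G a)) = 0 -> weyl_form G x (ratv a) = 0.
Proof.
move=> Ga xa0; have := weyl_form_refl x (ratv a) Ga.
rewrite /= xa0 scale0r subr0 pairing_ratv pairing_root_coroot //.
rewrite scaler_nat mulr2n opprD addrA subrr sub0r -scaleN1r.
rewrite weyl_formC weyl_formZl mulN1r weyl_formC => /eqP.
rewrite eq_sym -addr_eq0 -mulr2n.
by rewrite mulrn_eq0 => /eqP.
Qed.

(* Principal submatrices of the Cartan matrix are invertible. *)
Lemma levi_nondegenerate r (G : rootDatum r) (I : {set 'I_r})
    (c : 'I_r -> rat) :
  simply_connected G ->
  (forall k, k \in I ->
     pairing (\sum_(j in I) c j *: ratv (sroot G j))
       (ratv (scoroot G k)) = 0) ->
  \sum_(j in I) c j *: ratv (sroot G j) = 0.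
Proof.
move=> scG; set x := \sum_(j in I) _ => x0.
have xx0 : weyl_form G x x = 0.
  have : forall y,
      (forall k, k \in I -> weyl_form G (ratv (sroot G k)) y = 0) ->
      weyl_form G x y = 0.
    move=> y y0.
    apply: (big_rec (fun z => weyl_form G z y = 0)) => [|k z Ik z0].
      by rewrite /weyl_form big1 // => f _; rewrite /pairing mul0mx mxE mul0r.
    by rewrite weyl_formDl weyl_formZl y0 // mulr0 add0r.
  apply=> k Ik; rewrite weyl_formC weyl_form_root ?sroot_roots //.
  by rewrite -scorootE x0.
have {}xx0 k : pairing x (ratv (scoroot G k)) = 0.
  move/eqP: xx0; rewrite /weyl_form psumr_eq0 => [/allP/(_ (scoroot G k))|f _].
    rewrite mem_undup scorootE map_f ?sroot_roots //= mulf_eq0 orbb.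
    by move=> /(_ isT)/eqP.
  by rewrite -expr2 sqr_ge0.
have uC : (scoroot_mx G)^T \in unitmx by rewrite unitmx_tr scoroot_unit.
apply: (can_inj (mulmxK uC)).
by rewrite mul0mx; apply/rowP => k; rewrite pairing_rows xx0 mxE.
Qed.

Lemma sroot_indep r (G : rootDatum r) (I : {set 'I_r}) (c : 'I_r -> rat) :
  \sum_(j in I) c j *: ratv (sroot G j) = 0 -> forall k, k \in I -> c k = 0.
Proof.
move=> c0 k Ik; have: pairing 0 (fund_coweight G k) = 0.
  by rewrite /pairing mul0mx mxE.
rewrite -c0 pairing_suml (bigD1 k) //= big1 => [|j /andP[_ nejk]].
  by rewrite pairingZl fund_coweightP eqxx mulr1 addr0.
by rewrite pairingZl fund_coweightP (negPf nejk) mulr0.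
Qed.

Lemma sroot_expand r (G : rootDatum r) (x : 'rV[rat]_r) :
  x = \sum_k pairing x (fund_coweight G k) *: ratv (sroot G k).
Proof.
have uG := sroot_free G.
rewrite -[LHS](mulmxKV uG) mulmx_sum_row; apply: eq_bigr => k _.
rewrite rowK; congr (_ *: _); rewrite mxE pairingE.
by apply: eq_bigr => j _; rewrite !mxE -trmx_inv mxE.
Qed.

Lemma vertex_mx_unit r (G : rootDatum r) (I : {set 'I_r}) :
  simply_connected G -> vertex_mx G I \in unitmx.
Proof.
move=> scG; rewrite -unitmx_tr -row_free_unit -kermx_eq0.
apply/rowV0P => x /sub_kermxP x0.
have xk k : pairing x (if k \in I then ratv (scoroot G k)
                       else fund_coweight G k) = 0.
  by move/rowP/(_ k): x0; rewrite pairing_rows mxE.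
have xE : x = \sum_(k in I) pairing x (fund_coweight G k) *: ratv (sroot G k).
  rewrite [LHS](sroot_expand G) (bigID (mem I)) /= [X in _ + X]big1 ?addr0 //.
  by move=> k /negPf nIk; have := xk k; rewrite nIk => ->; rewrite scale0r.
rewrite xE; apply: levi_nondegenerate => // k Ik.
by rewrite -xE; have := xk k; rewrite Ik.
Qed.

Lemma vertexP r (G : rootDatum r) (I : {set 'I_r}) (lambda : 'rV[rat]_r) :
  simply_connected G -> unique (is_vertex G I lambda) (vertex G I lambda).
Proof.
move=> scG; have uM : (vertex_mx G I)^T \in unitmx.
  by rewrite unitmx_tr vertex_mx_unit.
set b : 'rV_r := \row_k (if k \in I then 0 else
                          pairing lambda (fund_coweight G k)).
have vE x : is_vertex G I lambda x <-> x *m (vertex_mx G I)^T = b.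
  split=> [[x1 x2]|xb].
    apply/rowP => k; rewrite pairing_rows mxE.
    case: ifPn => Ik; first exact: x1.
    by move: (x2 k Ik); rewrite pairingDl pairingNl => /subr0_eq.
  have xk k : pairing x (if k \in I then ratv (scoroot G k)
                         else fund_coweight G k) = b 0 k.
    by rewrite -xb pairing_rows.
  split=> k Ik; move: (xk k); rewrite mxE ?Ik ?(negPf Ik) // => xkE.
  by rewrite pairingDl pairingNl xkE subrr.
split=> [|x /vE xb]; first by apply/vE; rewrite mulmxKV.
by rewrite /vertex -/b -xb mulmxK.
Qed.

Lemma levi_sroot_unit r (G : rootDatum r) (I : {set 'I_r}) :
  simply_connected G -> sroot_mx (levi G I) \in unitmx.
Proof.
move=> scG; rewrite -row_free_unit -kermx_eq0.
apply/rowV0P => u /sub_kermxP u0.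
pose c j : rat := \sum_k (enum_val k == j)%:R * u 0 k.
have cE k : c (enum_val k) = u 0 k.
  rewrite /c (bigD1 k) //= eqxx mul1r big1 ?addr0 // => l nelk.
  by rewrite (inj_eq enum_val_inj) (negPf nelk) mul0r.
have sE (F : 'I_r -> 'rV[rat]_r) :
    \sum_(j in I) c j *: F j = \sum_k u 0 k *: F (enum_val k).
  by rewrite big_enum_val /=; apply: eq_bigr => k _; rewrite cE.
have c0 : \sum_(j in I) c j *: ratv (sroot G j) = 0.
  apply: levi_nondegenerate => // k Ik.
  rewrite sE pairing_suml -(enum_rankK_in Ik Ik).
  set l := enum_rank_in _ _; have: (u *m sroot_mx (levi G I)) 0 l = 0.
    by rewrite u0 mxE.
  rewrite mxE => ul; rewrite -[RHS]ul; apply: eq_bigr => j _.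
  by rewrite pairingZl pairing_ratv !mxE.
apply/rowP => k; rewrite mxE -cE.
exact: (sroot_indep c0 (enum_valP k)).
Qed.

Lemma root_coordP r (G : rootDatum r) (I : {set 'I_r}) (x : 'rV[rat]_#|I|) :
  simply_connected G ->
  x = \sum_k root_coord (levi G I) x k *: ratv (sroot (levi G I) k).
Proof.
move=> scG; rewrite -[LHS](mulmxKV (levi_sroot_unit I scG)) mulmx_sum_row.
by apply: eq_bigr => k _; rewrite rowK.
Qed.

(* Main.v *)
(** Write [varpi_i - v = sum_k c_k alpha_k], where [c_k = 0] off [I] and the
    pairings with [alpha_k^vee] ([k] in [I]) are those of [varpi_i].  Since the
    off-diagonal Cartan integers are nonpositive, a Weyl-invariant form makes
    every [c_k] nonnegative, and then [v] is dominant; thus [(varpi_i, v)] lies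
    in the cone.  If it is a sum of two elements of the cone, each of them again
    has first entry proportional to [varpi_i], second entry orthogonal to the
    [alpha_k^vee] with [k] in [I], and difference supported on [I]; the
    uniqueness of [v] as a vertex makes it a multiple of [(varpi_i, v)].  The
    same uniqueness identifies [v] with the second entry of the induced pair. *)
Require Import Defs.
From mathcomp Require Import all_boot all_order all_algebra.

Import Order.TTheory GRing.Theory Num.Theory.
Local Open Scope ring_scope.

Lemma pairing0l (R : comNzRingType) r (z : 'rV[R]_r) : pairing 0 z = 0.
Proof. by rewrite /pairing mul0mx mxE. Qed.

Lemma pairingBl (R : comNzRingType) r (x y z : 'rV[R]_r) :
  pairing (x - y) z = pairing x z - pairing y z.
Proof. by rewrite pairingDl pairingNl. Qed.

Lemma pairing_scoroot_inj {r} {G : baseDatum r} {x y : 'rV[rat]_r} :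
  simply_connected G ->
  (forall k, pairing x (ratv (scoroot G k)) = pairing y (ratv (scoroot G k))) ->
  x = y.
Proof.
move=> scG xy; have uC : (scoroot_mx G)^T \in unitmx.
  by rewrite unitmx_tr scoroot_unit.
apply: (can_inj (mulmxK uC)).
by apply/rowP => k; rewrite !pairing_rows xy.
Qed.

(** * Root coordinates and signs of Cartan integers *)

Lemma pairing_sroots_coweight {r} (G : rootDatum r) (c : 'I_r -> rat) k :
  pairing (\sum_j c j *: ratv (sroot G j)) (fund_coweight G k) = c k.
Proof.
rewrite pairing_suml (bigD1 k) //= big1 => [|j nejk].
  by rewrite pairingZl fund_coweightP eqxx mulr1 addr0.
by rewrite pairingZl fund_coweightP (negPf nejk) mulr0.
Qed.

Lemma root_coweight_sign {r} {G : rootDatum r} {a} : a \in Defs.roots G ->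
  (forall k, 0 <= pairing (ratv a) (fund_coweight G k)) \/
  (forall k, pairing (ratv a) (fund_coweight G k) <= 0).
Proof.
move=> Ga; have sumE (c : 'I_r -> nat) :
    ratv (\sum_k (c k)%:Z *: sroot G k)
    = \sum_k (c k)%:R *: ratv (sroot G k) :> 'rV[rat]_r.
  apply/rowP => j; rewrite !mxE !summxE rmorph_sum; apply: eq_bigr => k _.
  by rewrite !mxE rmorphM.
have [c [aE|aE]] := sroot_base Ga; [left|right] => k; rewrite aE.
  by rewrite sumE pairing_sroots_coweight.
have -> y : ratv (- y) = - ratv y :> 'rV[rat]_r.
  by apply/rowP => j; rewrite !mxE rmorphN.
by rewrite pairingNl sumE pairing_sroots_coweight oppr_le0.
Qed.

(* The root [s_k(alpha_j)] has coefficient 1 at [alpha_j], so its coefficient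
   at [alpha_k] is nonnegative. *)
Lemma cartan_off_diag {r} (G : rootDatum r) (j k : 'I_r) : j != k ->
  pairing (ratv (sroot G j)) (ratv (scoroot G k)) <= 0.
Proof.
move=> nejk; have := reflection_root (sroot_roots G k) (sroot_roots G j).
rewrite -scorootE; set n := pairing _ _ => Gs.
have sE l : pairing (ratv (sroot G j - n *: sroot G k)) (fund_coweight G l)
            = (j == l)%:R - n%:~R * (k == l)%:R.
  have -> : ratv (sroot G j - n *: sroot G k)
            = ratv (sroot G j) - n%:~R *: ratv (sroot G k) :> 'rV[rat]_r.
    by apply/rowP => l'; rewrite !mxE rmorphB rmorphM.
  by rewrite pairingBl pairingZl !fund_coweightP.
rewrite pairing_ratv -/n.
have [/(_ k)|/(_ j)] := root_coweight_sign Gs; rewrite sE eqxx.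
  by rewrite (negPf nejk) mulr1 sub0r oppr_ge0.
by rewrite eq_sym (negPf nejk) mulr0 subr0 ler10.
Qed.

(** * Positivity of the invariant form and membership in the cone *)

Lemma weyl_form_ge0 {r} (G : rootDatum r) x : 0 <= weyl_form G x x.
Proof. by apply: sumr_ge0 => f _; rewrite -expr2 sqr_ge0. Qed.

Lemma weyl_form_eq0 {r} {G : rootDatum r} {x} :
  simply_connected G -> weyl_form G x x = 0 -> x = 0.
Proof.
move=> scG xx0; apply: (pairing_scoroot_inj scG) => k; rewrite pairing0l.
move/eqP: xx0; rewrite /weyl_form psumr_eq0 => [/allP/(_ (scoroot G k))|f _].
  rewrite mem_undup scorootE map_f ?sroot_roots //= mulf_eq0 orbb.
  by move=> /(_ isT)/eqP.
by rewrite -expr2 sqr_ge0.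
Qed.

(** Subtracting half of [pairing x (ratv (scoroot G k))] times the simple root leaves a vector fixed
    by the simple reflection, hence orthogonal to that root. This turns signs of pairings with
    coroots into signs of the form. *)
Lemma weyl_form_sroot {r} (G : rootDatum r) x k :
  weyl_form G x (ratv (sroot G k)) =
  pairing x (ratv (scoroot G k)) / 2
    * weyl_form G (ratv (sroot G k)) (ratv (sroot G k)).
Proof.
set a := ratv (sroot G k); set t := pairing x _ / 2.
have : weyl_form G (x + (- t) *: a) a = 0.
  apply: weyl_form_root; rewrite ?sroot_roots // -scorootE.
  rewrite pairingDl pairingZl pairing_ratv scorootE.
  rewrite pairing_root_coroot ?sroot_roots // -scorootE mulNr.
  by rewrite divfK ?subrr.
by rewrite weyl_formDl weyl_formZl mulNr => /subr0_eq.
Qed.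

Lemma weyl_form_suml {r} (G : rootDatum r) (J : finType) (P : pred J)
    (F : J -> 'rV[rat]_r) y :
  weyl_form G (\sum_(i | P i) F i) y = \sum_(i | P i) weyl_form G (F i) y.
Proof.
apply: (big_morph (fun x => weyl_form G x y)) => [x z|].
  exact: weyl_formDl.
by rewrite -(scale0r 0) weyl_formZl mul0r.
Qed.

(* If [n] is minus the part of [x] with negative coordinates, then
   [(n, n) = (x + n, n) - (x, n) <= 0]. *)
Lemma coweight_ge0 {r} {G : rootDatum r} {x : 'rV[rat]_r} :
  simply_connected G ->
  (forall k, pairing x (fund_coweight G k) < 0 ->
     0 <= pairing x (ratv (scoroot G k))) ->
  forall k, 0 <= pairing x (fund_coweight G k).
Proof.
move=> scG x_ge0; pose c k : rat := pairing x (fund_coweight G k).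
pose n : 'rV[rat]_r := \sum_(k | c k < 0) - c k *: ratv (sroot G k).
have xnE : x + n = \sum_(k | ~~ (c k < 0)) c k *: ratv (sroot G k).
  rewrite [x in LHS](sroot_expand G) (bigID (fun k => c k < 0)) /=.
  rewrite addrAC -big_split big1 ?add0r // => k _.
  by rewrite scaleNr /= subrr.
have xn_ge0 : 0 <= weyl_form G x n.
  rewrite weyl_formC weyl_form_suml; apply: sumr_ge0 => k ck.
  rewrite weyl_formZl mulr_ge0 ?oppr_ge0 ?(ltW ck) //.
  rewrite weyl_formC weyl_form_sroot mulr_ge0 ?weyl_form_ge0 //.
  by rewrite divr_ge0 ?x_ge0.
(* [x + n] and [n] have nonnegative coefficients on disjoint sets of simple roots, so only
   off-diagonal Cartan integers enter. *)
have pn_le0 : weyl_form G (x + n) n <= 0.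
  rewrite xnE weyl_form_suml; apply: sumr_le0 => j; rewrite -leNgt => cj.
  rewrite weyl_formZl mulr_ge0_le0 // weyl_formC weyl_form_suml.
  apply: sumr_le0 => k ck.
  rewrite weyl_formZl mulr_ge0_le0 ?oppr_ge0 ?(ltW ck) //.
  rewrite weyl_form_sroot mulr_le0_ge0 ?weyl_form_ge0 //.
  rewrite mulr_le0_ge0 ?invr_ge0 // cartan_off_diag //.
  by apply: contraL ck => /eqP ->; rewrite -leNgt.
have n0 : n = 0.
  apply: (weyl_form_eq0 scG); apply/eqP; rewrite eq_le weyl_form_ge0 andbT.
  by apply: le_trans pn_le0; rewrite weyl_formDl lerDr.
move=> k; rewrite leNgt; apply/negP => ck.
have : pairing n (fund_coweight G k) = - c k.
  rewrite pairing_suml (bigD1 k) //= big1 => [|j /andP[_ nejk]].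
    by rewrite pairingZl fund_coweightP eqxx mulr1 addr0.
  by rewrite pairingZl fund_coweightP (negPf nejk) mulr0.
rewrite n0 pairing0l => /eqP; rewrite eq_sym oppr_eq0 => /eqP ck0.
by move: ck; rewrite -/(c k) ck0 ltxx.
Qed.

(** A negative coordinate of [lambda - v] could only occur in [I], where [v] pairs to 0 and
    dominance of [lambda] supplies the hypothesis of [coweight_ge0]. *)
Lemma dominant_vertex_cone {r} {G : rootDatum r} {I : {set 'I_r}} {lambda v} :
  simply_connected G -> dominant G lambda -> is_vertex G I lambda v ->
  kostka_cone G (lambda, v).
Proof.
move=> scG lambda_dom [vI vJ]; pose x := lambda - v.
have x_ge0 k : 0 <= pairing x (fund_coweight G k).
  apply: (coweight_ge0 scG) => {}k xk.
  have Ik : k \in I by apply: contraTT xk => /vJ ->; rewrite ltxx.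
  by rewrite pairingBl vI // subr0; apply: lambda_dom.
split=> //= [k|]; last first.
  exists (fun k => pairing x (fund_coweight G k)); split=> //.
  exact: sroot_expand.
have [/vI -> //|nIk] := boolP (k \in I).
(* Outside [I] the coordinate of [x] at [k] vanishes, so [x] pairs nonpositively with this coroot
   and subtracting it preserves dominance. *)
have -> : v = lambda - x by rewrite /x opprB addrC subrK.
rewrite pairingBl subr_ge0; apply: le_trans (lambda_dom k).
rewrite (sroot_expand G x) pairing_suml; apply: sumr_le0 => j _.
have [->|nejk] := eqVneq j k; first by rewrite /x vJ // scale0r pairing0l.
by rewrite pairingZl mulr_ge0_le0 // cartan_off_diag.
Qed.

(** * Vertices and extremal rays *)

Lemma is_vertexZ {r} {G : baseDatum r} {I : {set 'I_r}} s {lambda v} :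
  is_vertex G I lambda v -> is_vertex G I (s *: lambda) (s *: v).
Proof.
move=> [vI vJ]; split=> k Ik; first by rewrite pairingZl vI // mulr0.
by rewrite -scalerBr pairingZl vJ // mulr0.
Qed.

Lemma is_vertex_uniq {r} {G : rootDatum r} {I : {set 'I_r}} {lambda v w} :
  simply_connected G -> is_vertex G I lambda v -> is_vertex G I lambda w ->
  v = w.
Proof. by move=> /(vertexP I lambda)[_ uv] /uv <- /uv <-. Qed.

Lemma addr_ge0_eq0 {R : numDomainType} {a b : R} :
  0 <= a -> 0 <= b -> a + b = 0 -> a = 0.
Proof. by move=> a0 b0 /eqP; rewrite paddr_eq0 // => /andP[/eqP]. Qed.

Lemma kostka_coweight_ge0 {r} {G : rootDatum r} {p} :
  kostka_cone G p -> forall k, 0 <= pairing (p.1 - p.2) (fund_coweight G k).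
Proof.
by case=> _ _ [c [c_ge0 ->]] k; rewrite pairing_sroots_coweight c_ge0.
Qed.

Lemma fund_weight_dominant {r} {G : baseDatum r} i :
  simply_connected G -> dominant G (fund_weight G i).
Proof. by move=> scG k; rewrite fund_weightP. Qed.

Lemma fund_weight_vertex_extremal {r} {G : rootDatum r} {I : {set 'I_r}} {i v} :
  simply_connected G -> is_vertex G I (fund_weight G i) v ->
  extremal_ray (kostka_cone G) (fund_weight G i, v).
Proof.
move=> scG vV; split.
- exact: dominant_vertex_cone (fund_weight_dominant i scG) vV.
- apply/eqP => -[w0 _]; have := fund_weightP i i scG.
  by rewrite w0 pairing0l eqxx => /esym/eqP; rewrite oner_eq0.
move=> [l m] [l' m'] Ca Cb [lE mE].
have [/= l_ge0 m_ge0 _] := Ca; have [/= l'_ge0 m'_ge0 _] := Cb.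
pose s := pairing l (ratv (scoroot G i)).
have lsE : l = s *: fund_weight G i.
  apply: (pairing_scoroot_inj scG) => k; rewrite pairingZl fund_weightP //.
  have [<-|neik] := eqVneq; first by rewrite mulr1.
  rewrite mulr0; apply: (addr_ge0_eq0 (l_ge0 k) (l'_ge0 k)).
  by rewrite -pairingDl lE fund_weightP // (negPf neik).
exists s; split; first exact: l_ge0.
congr pair; first exact: lsE.
have [vI vJ] := vV.
(* It remains to see that [m] is itself the vertex of [l]: nonnegative terms with zero sum vanish,
   both for coroots in [I] and for coweights outside it. *)
apply: (is_vertex_uniq scG) (is_vertexZ s vV).
rewrite -lsE; split=> k Ik.
  apply: (addr_ge0_eq0 (m_ge0 k) (m'_ge0 k)).
  by rewrite -pairingDl mE vI.
have := addr_ge0_eq0 (kostka_coweight_ge0 Ca k) (kostka_coweight_ge0 Cb k).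
by apply; rewrite -pairingDl /= addrACA -opprD lE mE vJ.
Qed.

(** * Induction from the Levi subgroup *)

Lemma ext0_fund_weight {r} {G : baseDatum r} {I : {set 'I_r}} k :
  simply_connected G ->
  ext0 G (fund_weight (levi G I) k) = fund_weight G (enum_val k).
Proof.
move=> scG; rewrite /ext0 (bigD1 k) //= big1 => [|j nejk].
  rewrite (fund_weightP _ _ (@simply_connected_levi _ _ _)).
  by rewrite eqxx scale1r addr0.
rewrite (fund_weightP _ _ (@simply_connected_levi _ _ _)) eq_sym.
by rewrite (negPf nejk) scale0r.
Qed.

(** The simple roots of [levi G I] are restrictions of those of [G], so on [I] the subtracted sum
    has the same coroot pairings as [x]; the coweights outside [I] kill that sum. *)
Lemma Ind0_vertex {r} {G : rootDatum r} {I : {set 'I_r}} (x : 'rV[rat]_#|I|) :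
  simply_connected G -> is_vertex G I (Ind G (x, 0)).1 (Ind G (x, 0)).2.
Proof.
move=> scG; rewrite /Ind /= subr0; split=> k Ik.
  rewrite -(enum_rankK_in Ik Ik); set l := enum_rank_in _ _.
  rewrite pairingBl ext0_in // [in pairing x _](root_coordP x scG).
  rewrite !pairing_suml; apply/eqP; rewrite subr_eq0; apply/eqP.
  apply: eq_bigr => j _; rewrite !pairingZl !pairing_ratv; congr (_ * _%:~R).
  (* Coroots of the Levi are standard basis vectors, so this pairing reads off a Cartan integer of
     [G]. *)
  by rewrite {1}/pairing trmx_delta -colE !mxE.
rewrite subKr pairing_suml big1 // => j _.
rewrite pairingZl fund_coweightP; case: eqP => [jk|]; last by rewrite mulr0.
by rewrite -jk enum_valP in Ik.
Qed.

Theorem corollary6p8 (r : nat) (G : rootDatum r)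
    (Gsimple : is_simple G) (Gsc : simply_connected G)
    (I : {set 'I_r}) (Lsimple : is_simple (levi G I))
    (i : 'I_r) (Ii : i \in I) :
  extremal_ray (kostka_cone G) (fund_weight G i, vertex G I (fund_weight G i))
  /\ (fund_weight G i, vertex G I (fund_weight G i))
     = Ind G (fund_weight (levi G I) (enum_rank_in Ii i), 0).
Proof.
have [vV _] := vertexP I (fund_weight G i) Gsc.
split; first exact: fund_weight_vertex_extremal vV.
have := @Ind0_vertex _ _ _ (fund_weight (levi G I) (enum_rank_in Ii i)) Gsc.
have : (Ind G (fund_weight (levi G I) (enum_rank_in Ii i), 0)).1
       = fund_weight G i.
  by rewrite /= ext0_fund_weight // enum_rankK_in.
case: (Ind _ _) => l m /= -> /(is_vertex_uniq Gsc vV) -> //.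
Qed.
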